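(* Consider the CDT problem $p^\star=\min\{\mathbf{x}^\top\mathbf{Q}\mathbf{x}+\mathbf{q}^\top\mathbf{x} : \mathbf{x}^\top\mathbf{x}\le 1,\ \mathbf{x}^\top\mathbf{A}\mathbf{x}+\mathbf{a}^\top\mathbf{x}\le a_0\}$ under the standing assumptions listed in the context, and let $\lambda_{\mathbb{R}^n}$ be a maximizer of the dual function $p_{\mathbb{R}^n}$ over $[0,\infty)$. Then $p_{\mathbb{R}^n}(\lambda_{\mathbb{R}^n})\neq p^\star$ if and only if $P_{\mathbb{R}^n}(\lambda_{\mathbb{R}^n})$ contains exactly two points (so that $|J_{\lambda_{\mathbb{R}^n}}|=1$) and $$0\in\left(h^{\min}_{\mathbb{R}^n}(\lambda_{\mathbb{R}^n}),\,h^{\max}_{\mathbb{R}^n}(\lambda_{\mathbb{R}^n})\right).$$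
   Context: Here $\mathbf{Q},\mathbf{A}\in\mathbb{R}^{n\times n}$ are symmetric, $\mathbf{A}$ is positive definite, $\mathbf{q},\mathbf{a}\in\mathbb{R}^n$, $a_0\in\mathbb{R}$. Put $f(\mathbf{x})=\mathbf{x}^\top\mathbf{Q}\mathbf{x}+\mathbf{q}^\top\mathbf{x}$ and $h(\mathbf{x})=\mathbf{x}^\top\mathbf{A}\mathbf{x}+\mathbf{a}^\top\mathbf{x}-a_0$. Standing assumptions: $\min_{\mathbf{x}^\top\mathbf{x}\le 1}h(\mathbf{x})<0$, and every minimizer of $f$ over the unit ball $\{\mathbf{x}^\top\mathbf{x}\le 1\}$ satisfies $h(\mathbf{x})>0$. For $\lambda\ge 0$ define $$p_{\mathbb{R}^n}(\lambda)=\min_{\mathbf{x}^\top\mathbf{x}\le 1} f(\mathbf{x})+\lambda h(\mathbf{x}),\qquad P_{\mathbb{R}^n}(\lambda)=\arg\min_{\mathbf{x}^\top\mathbf{x}\le 1} f(\mathbf{x})+\lambda h(\mathbf{x}),$$ $h^{\min}_{\mathbb{R}^n}(\lambda)=\min_{\mathbf{x}\in P_{\mathbb{R}^n}(\lambda)}h(\mathbf{x})$ and $h^{\max}_{\mathbb{R}^n}(\lambda)=\max_{\mathbf{x}\in P_{\mathbb{R}^n}(\lambda)}h(\mathbf{x})$. $|J_\lambda|$ denotes the multiplicity of the smallest eigenvalue of $\mathbf{Q}+\lambda\mathbf{A}$. The value $\max_{\lambda\ge0}p_{\mathbb{R}^n}(\lambda)=p_{\mathbb{R}^n}(\lambda_{\mathbb{R}^n})$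 is the dual Lagrangian bound (the maximum is attained). *)

(* Defs.v *)
From HB Require Import structures.
From mathcomp Require Import all_boot all_order all_algebra.
From mathcomp Require Import all_classical all_reals.

Set Implicit Arguments.
Unset Strict Implicit.
Unset Printing Implicit Defensive.

Import Order.TTheory GRing.Theory Num.Theory.

Local Open Scope classical_set_scope.
Local Open Scope ring_scope.

Section Extrema.
Context {R : realType} {T : Type}.
Implicit Types (g : T -> R) (S : set T).

Definition argmin g S : set T := [set x | S x /\ forall y, S y -> g x <= g y].
Definition argmax g S : set T := [set x | S x /\ forall y, S y -> g y <= g x].

(* The attained extremum, characterised by minimumE and maximumE; the value is
   the junk 0 only when the extremum is not attained. *)
Definition minimum g S : R := xget 0 (g @` argmin g S).
Definition maximum g S : R := xget 0 (g @` argmax g S).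

Lemma minimumE g S x : argmin g S x -> minimum g S = g x.
Proof.
move=> [Sx minx]; apply: xget_unique; first by exists x.
by move=> _ [y [Sy miny] <-]; apply/le_anti; rewrite miny//= minx.
Qed.

Lemma maximumE g S x : argmax g S x -> maximum g S = g x.
Proof.
move=> [Sx maxx]; apply: xget_unique; first by exists x.
by move=> _ [y [Sy maxy] <-]; apply/le_anti; rewrite maxx//= maxy.
Qed.

End Extrema.

Section CDT.
Context {R : realType} {n : nat}.
Implicit Types (M Q A : 'M[R]_n) (q a x : 'cV[R]_n) (lam : R).

Definition posdef M : Prop := forall x, x != 0 -> 0 < (x^T *m M *m x) 0 0.

Definition unit_ball : set 'cV[R]_n := [set x | (x^T *m x) 0 0 <= 1].

Definition objf Q q x : R := (x^T *m Q *m x) 0 0 + (q^T *m x) 0 0.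

Definition conh A a (a0 : R) x : R := (x^T *m A *m x) 0 0 + (a^T *m x) 0 0 - a0.

Definition cdt_feasible A a (a0 : R) : set 'cV[R]_n :=
  [set x | (x^T *m x) 0 0 <= 1 /\ (x^T *m A *m x) 0 0 + (a^T *m x) 0 0 <= a0].

Definition cdt_value Q q A a (a0 : R) : R :=
  minimum (objf Q q) (cdt_feasible A a a0).

Definition lagrangian Q q A a (a0 : R) lam x : R :=
  objf Q q x + lam * conh A a a0 x.

Definition dualp Q q A a (a0 : R) lam : R :=
  minimum (lagrangian Q q A a a0 lam) unit_ball.

Definition dualP Q q A a (a0 : R) lam : set 'cV[R]_n :=
  argmin (lagrangian Q q A a a0 lam) unit_ball.

Definition hmin Q q A a (a0 : R) lam : R :=
  minimum (conh A a a0) (dualP Q q A a a0 lam).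

Definition hmax Q q A a (a0 : R) lam : R :=
  maximum (conh A a a0) (dualP Q q A a a0 lam).

Definition smallest_eigenvalue M : R :=
  minimum id [set mu | eigenvalue M mu].

(* For symmetric M the algebraic and geometric multiplicities coincide; this is
   the dimension of the eigenspace. *)
Definition smallest_eigenvalue_mult M : nat :=
  \rank (eigenspace M (smallest_eigenvalue M)).

Definition exactly_two_points (P : set 'cV[R]_n) : Prop :=
  exists x y, x <> y /\ P = [set x; y].

End CDT.

(* Main.v *)
(* At a maximizer lam of the dual function, the minimizers P of the Lagrangian
   over the ball include one with h <= 0 and, since lam > 0 by infeasibility of
   the minimizers of f, one with h >= 0: otherwise moving lam slightly would
   increase the dual value. There is no duality gap exactly when some point of P
   satisfies h = 0. By the optimality conditions of the trust region problem, P
   is the intersection of the ball (multiplier mu = 0) or of the sphere (mu > 0)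
   with an affine space directed by ker (Q + lam A + mu I). If P contains two
   points and a third one, these two can be joined inside P by a segment or a
   circular arc, so h vanishes on P whenever it changes sign there. If P
   consists of exactly two points, then mu > 0 and the kernel is a line, i.e.
   -mu is a simple smallest eigenvalue. *)

Require Import Defs.
From HB Require Import structures.
From mathcomp Require Import all_boot all_order all_algebra.
From mathcomp Require Import all_classical all_reals.
From mathcomp Require Import topology normedtype derive.
From mathcomp Require Import ring lra.

Set Implicit Arguments.
Unset Strict Implicit.
Unset Printing Implicit Defensive.

Import Order.TTheory GRing.Theory Num.Theory.
Import numFieldNormedType.Exports.

Local Open Scope classical_set_scope.
Local Open Scope ring_scope.

(** * Sign of a quadratic polynomial near zero *)

Section SmallQuadratics.
Context {R : realFieldType}.
Implicit Types c l s e t : R.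

(** For [t <= 1] the two lower-order terms are at least [- (|l| + |s|) t]. The extra 1 in [K] leaves
    a surplus [t > 0] once [t * K <= c]. *)
Lemma small_quad_gt0 c l s : 0 < c ->
  exists2 e, 0 < e & forall t, 0 < t <= e -> 0 < c + l * t + s * t ^+ 2.
Proof.
move=> c0; set K := `|l| + `|s| + 1.
have K0 : 0 < K by rewrite ltr_wpDl// addr_ge0.
exists (Num.min 1 (c / K)); first by rewrite lt_min ltr01 divr_gt0.
move=> t; rewrite le_min ler_pdivlMr// => /andP[t0 /andP[t1 tK]].
have lt_ : - (`|l| * t) <= l * t.
  by rewrite -mulNr ler_pM2r// lerNl ler_normr lexx orbT.
have st_ : - (`|s| * t) <= s * t ^+ 2.
  rewrite -mulNr expr2 mulrA ler_pM2r//.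
  apply: (@le_trans _ _ (- (`|s| * t))); first by rewrite lerN2 ler_piMr.
  by rewrite -mulNr ler_pM2r// lerNl ler_normr lexx orbT.
have : t * K = `|l| * t + `|s| * t + t by rewrite /K; ring.
by move=> E; rewrite E in tK; lra.
Qed.

(** The limit [t -> 0+], which extracts first-order conditions from increments divided by [t]. *)
Lemma small_quad_ge0 e c l s : 0 < e ->
  (forall t, 0 < t <= e -> 0 <= c + l * t + s * t ^+ 2) -> 0 <= c.
Proof.
move=> e0 H; rewrite leNgt; apply/negP => c0.
have [|e1 e10 H1] := @small_quad_gt0 (- c) (- l) (- s).
  by rewrite oppr_gt0.
have t0 : 0 < Num.min e e1 by rewrite lt_min e0.
have := H (Num.min e e1); rewrite t0 ge_min lexx => /(_ isT).
have := H1 (Num.min e e1); rewrite t0 ge_min lexx orbT => /(_ isT).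
lra.
Qed.

End SmallQuadratics.

(** * Continuity of sums and products *)

Section RealContinuity.
Context {R : realType} {T : topologicalType}.
Implicit Types f g : T -> R.

Lemma continuous_add f g : continuous f -> continuous g ->
  continuous (fun x => f x + g x).
Proof. by move=> cf cg x; apply: cvgD; [exact: cf|exact: cg]. Qed.

Lemma continuous_mul f g : continuous f -> continuous g ->
  continuous (fun x => f x * g x).
Proof. by move=> cf cg x; apply: cvgM; [exact: cf|exact: cg]. Qed.

End RealContinuity.

(** * Inner product, quadratic functions, compactness of the ball *)

Section Dot.
Context {R : realType} {n : nat}.
Implicit Types (x y z u v w d : 'cV[R]_n) (M N : 'M[R]_n) (c : R).

Definition dot u v : R := (u^T *m v) 0 0.

Lemma dotE u v : dot u v = \sum_i u i 0 * v i 0.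
Proof. by rewrite /dot mxE; apply: eq_bigr => i _; rewrite mxE. Qed.

Lemma dotC u v : dot u v = dot v u.
Proof. by rewrite !dotE; apply: eq_bigr => i _; rewrite mulrC. Qed.

Lemma dotDr u v w : dot u (v + w) = dot u v + dot u w.
Proof. by rewrite /dot mulmxDr mxE. Qed.

Lemma dotDl u v w : dot (v + w) u = dot v u + dot w u.
Proof. by rewrite dotC dotDr !(dotC u). Qed.

Lemma dotZr c u v : dot u (c *: v) = c * dot u v.
Proof. by rewrite /dot -scalemxAr mxE. Qed.

Lemma dotZl c u v : dot (c *: u) v = c * dot u v.
Proof. by rewrite dotC dotZr dotC. Qed.

Lemma dotNr u v : dot u (- v) = - dot u v.
Proof. by rewrite -scaleN1r dotZr mulN1r. Qed.

Lemma dotNl u v : dot (- u) v = - dot u v.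
Proof. by rewrite dotC dotNr dotC. Qed.

Lemma dot0r u : dot u 0 = 0.
Proof. by rewrite -(scale0r 0) dotZr mul0r. Qed.

Lemma dot_ge0 u : 0 <= dot u u.
Proof. by rewrite dotE sumr_ge0// => i _; rewrite -expr2 sqr_ge0. Qed.

Lemma dot_eq0 u : (dot u u == 0) = (u == 0).
Proof.
apply/eqP/eqP => [|->]; last exact: dot0r.
rewrite dotE => /eqP.
rewrite psumr_eq0 => [|i _]; last by rewrite -expr2 sqr_ge0.
move=> /allP H; apply/colP => i; rewrite mxE.
by have := H i; rewrite mem_index_enum mulf_eq0 orbb => /(_ isT)/eqP.
Qed.

Lemma dot_gt0 u : u != 0 -> 0 < dot u u.
Proof. by move=> u0; rewrite lt_def dot_ge0 dot_eq0 u0. Qed.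

Lemma dot_sym M u v : M^T = M -> dot u (M *m v) = dot v (M *m u).
Proof. by move=> Ms; rewrite [RHS]dotC /dot trmx_mul Ms mulmxA. Qed.

Lemma unit_ballE u : unit_ball u = (dot u u <= 1). Proof. by []. Qed.

Definition dotDZ :=
  (mulmxDr, =^~ scalemxAr, mulmxN, dotDl, dotDr, dotZl, dotZr, dotNl, dotNr).

Definition quad M b c x : R := dot x (M *m x) + dot b x + c.

Lemma quadDZ M b c x d t : M^T = M -> quad M b c (x + t *: d) =
  quad M b c x + dot (2 *: (M *m x) + b) d * t + dot d (M *m d) * t ^+ 2.
Proof.
move=> Ms; rewrite /quad !dotDZ (dot_sym x d Ms) (dotC (M *m x) d); ring.
Qed.

Lemma quad_sum M b c x : quad M b c x =
  (\sum_i x i 0 * (\sum_j M i j * x j 0)) + (\sum_i b i 0 * x i 0) + c.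
Proof.
rewrite /quad !dotE; congr (_ + _ + _).
by apply: eq_bigr => i _; rewrite mxE.
Qed.

Lemma quad_continuous M b c : continuous (quad M b c).
Proof.
have Ci (i : 'I_n) : continuous (fun x : 'cV[R]_n => x i 0 : R).
  exact: coord_continuous.
have Cs (F : 'I_n -> 'cV[R]_n -> R) : (forall i, continuous (F i)) ->
    continuous (fun x => \sum_i F i x).
  move=> CF; apply: (@continuous_big R 'I_n +%R 0 xpredT _ _ _ F) => //.
  exact: add_continuous.
have -> : quad M b c = (fun x =>
  (\sum_i x i 0 * (\sum_j M i j * x j 0)) + (\sum_i b i 0 * x i 0) + c).
  by apply/funext => x; rewrite quad_sum.
apply: continuous_add; last exact: cst_continuous.
apply: continuous_add; apply: (Cs (fun i x => _)) => i; apply: continuous_mul.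
- exact: Ci.
- apply: (Cs (fun j x => _)) => j; apply: continuous_mul; last exact: Ci.
  exact: cst_continuous.
- exact: cst_continuous.
- exact: Ci.
Qed.

Lemma trmx_continuous_rV : continuous (fun v : 'rV[R]_n => v^T).
Proof.
move=> v s /= /nbhs_ballP[e e0 es].
apply/nbhs_ballP; exists e => //= w [_ vw]; apply: es; split => // i j.
by rewrite !mxE; exact: vw.
Qed.

(** The ball is a closed subset of the cube with sides [[-1, 1]], itself the continuous image under
    transposition of a compact cube of row vectors. *)
Lemma unit_ball_compact : compact (@unit_ball R n).
Proof.
have cube := @rV_compact R n (fun=> `[(-1 : R), 1]%classic)
  (fun=> @segment_compact _ _ _).
have cB := continuous_compact (continuous_subspaceT trmx_continuous_rV) cube.
apply: (subclosed_compact _ cB).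
  have -> : unit_ball = quad 1%:M 0 0 @^-1` [set r : R | r <= 1].
    by apply/seteqP; split => x; rewrite /unit_ball /quad /= !mul1mx
      -/(dot x x) [dot 0 x]dotC dot0r !addr0.
  apply: preimage_closed; last exact: closed_le.
  by move=> x _; exact: quad_continuous.
move=> x; rewrite unit_ballE => x1; exists x^T; last exact: trmxK.
move=> i /=; rewrite in_itv /= mxE.
have : x i 0 ^+ 2 <= 1.
  apply: le_trans x1; rewrite dotE (bigD1 i)//= -expr2 lerDl.
  by rewrite sumr_ge0// => j _; rewrite -expr2 sqr_ge0.
by move=> ?; apply/andP; split; nra.
Qed.

End Dot.

(** * Minima over a compact set and their perturbation *)

Section CompactMinimum.
Context {R : realType} {T : topologicalType}.
Implicit Types (f h : T -> R) (K : set T).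

Lemma argmin_nonempty f K : continuous f -> compact K -> K !=set0 ->
  argmin f K !=set0.
Proof.
move=> cf cK K0.
have [c cK' minc] := compact_EVT_min K0 cK (continuous_subspaceT cf).
by exists c; split; [exact: set_mem|move=> y Ky; apply: minc; exact: mem_set].
Qed.

Lemma compact_sublevel h K : continuous h -> compact K ->
  compact (K `&` [set x | h x <= 0]).
Proof.
move=> ch cK; apply: compact_closedI => //.
apply: (preimage_closed (f := h) (D := [set r : R | r <= 0])).
  by move=> x _; exact: ch.
exact: closed_le.
Qed.

(** Where [h > 0] the perturbation only increases the value. On the compact part [h <= 0], [f]
    exceeds [p] by a fixed margin and [h] is bounded below, so a small [e] cannot use up the
    margin. *)
Lemma perturbed_minimum_gt f h K p : continuous f -> continuous h ->
  compact K -> (forall x, K x -> p <= f x) ->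
  (forall x, K x -> h x <= 0 -> p < f x) ->
  exists2 e0, 0 < e0 &
    forall e x, 0 < e <= e0 -> K x -> p < f x + e * h x.
Proof.
move=> cf ch cK fp hp; pose K' := K `&` [set x | h x <= 0].
have [[x0 K'x0]|K'0] := pselect (K' !=set0); last first.
  exists 1 => // e x /andP[e0 _] Kx.
  have hx : 0 < h x.
    by rewrite ltNge; apply/negP => hx; apply: K'0; exists x.
  by have := fp x Kx; have := mulr_gt0 e0 hx; lra.
have cK' : compact K' by exact: compact_sublevel.
have [c [[Kc hc] minc]] := argmin_nonempty cf cK' (ex_intro _ x0 K'x0).
have [m [[Km hm] minm]] := argmin_nonempty ch cK' (ex_intro _ x0 K'x0).
have fc : 0 < f c - p by rewrite subr_gt0; exact: hp.
have hm1 : 0 < 1 - h m by move: hm => /=; lra.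
(* Margin over worst drop [- h m]; the added 1 keeps the denominator positive and leaves a strict
   surplus [e]. *)
exists ((f c - p) / (1 - h m)) => [|e x]; first by rewrite divr_gt0.
rewrite ler_pdivlMr// => /andP[e0 ee] Kx.
have [hx|hx] := leP (h x) 0; last first.
  by have := fp x Kx; have := mulr_gt0 e0 hx; lra.
have fx := minc x (conj Kx hx); have := minm x (conj Kx hx).
rewrite -(ler_pM2l e0); lra.
Qed.

End CompactMinimum.

(** * Optimality conditions of the trust region problem *)

Section TrustRegion.
Context {R : realType} {n : nat}.
Implicit Types (x y z u v w d b : 'cV[R]_n) (M N : 'M[R]_n) (c mu : R).

Definition psd N := forall d, 0 <= dot d (N *m d).

(** Such a [d] minimizes the form, so its derivative there along [- N d] cannot be negative. *)
Lemma psd_ker N d : N^T = N -> psd N -> dot d (N *m d) = 0 -> N *m d = 0.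
Proof.
move=> Ns Np d0; apply/eqP; rewrite -dot_eq0; apply/eqP/le_anti.
rewrite dot_ge0 andbT -oppr_ge0; set v := N *m d.
suff : 0 <= - (2 * dot v v) by lra.
apply: (@small_quad_ge0 _ 1 _ (dot v (N *m v)) 0) => // t /andP[t0 _].
have := Np (d + (- t) *: v); rewrite !dotDZ d0 (dot_sym d v Ns) -/v => H.
by rewrite -(pmulr_rge0 _ t0); move: H; congr (0 <= _); ring.
Qed.

(* [N = M + mu I] is positive semidefinite in every direction, not just on the
   tangent space of the sphere: when [dot w w = 1], comparing [w] with its
   reflection along [d] evaluates [N] at any [d] not orthogonal to [w]. *)
Lemma argmin_ball_kkt M b c w : M^T = M -> argmin (quad M b c) unit_ball w ->
  exists mu, [/\ 0 <= mu, psd (M + mu%:M),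
    2 *: ((M + mu%:M) *m w) + b = 0 & mu * (1 - dot w w) = 0].
Proof.
move=> Ms [wB minw]; rewrite unit_ballE in wB.
pose G := 2 *: (M *m w) + b; have defG : 2 *: (M *m w) + b = G by [].
have inc d t : dot (w + t *: d) (w + t *: d) <= 1 ->
    0 <= dot G d * t + dot d (M *m d) * t ^+ 2.
  by move=> /minw; rewrite quadDZ// defG; lra.
clearbody G.
have normE d t : dot (w + t *: d) (w + t *: d) =
    dot w w + 2 * dot w d * t + dot d d * t ^+ 2.
  by rewrite !dotDZ (dotC d w); ring.
have feas d e : 0 < e -> (forall t, 0 < t <= e ->
    dot (w + t *: d) (w + t *: d) <= 1) -> 0 <= dot G d.
  move=> e0 H; apply: (@small_quad_ge0 _ e _ (dot d (M *m d)) 0) => // t te.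
  have /andP[t0 _] := te; rewrite -(pmulr_rge0 _ t0).
  by have := inc d t (H t te); congr (0 <= _); ring.
(* In the interior every direction is feasible, so the gradient [G] vanishes and [mu = 0]. *)
have [w1|w1] := ltP (dot w w) 1.
  have Gd d : 0 <= dot G d.
    have c0 : 0 < 1 - dot w w by rewrite subr_gt0.
    have [e e0 H] := small_quad_gt0 (- (2 * dot w d)) (- dot d d) c0.
    by apply: (feas d e e0) => t /H; rewrite normE; lra.
  have G0 : G = 0.
    apply/eqP; rewrite -dot_eq0; apply/eqP/le_anti; rewrite dot_ge0 andbT.
    by have := Gd (- G); rewrite dotNr; lra.
  exists 0; split=> //; last by rewrite mul0r.
    move=> d; rewrite raddf0 addr0.
    have c0 : 0 < 1 - dot w w by rewrite subr_gt0.
    have [e e0 H] := small_quad_gt0 (2 * - dot w d) (- dot d d) c0.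
    have te : 0 < e <= e by rewrite e0 lexx.
    have := inc d e; rewrite normE G0 [dot 0 _]dotC dot0r mul0r add0r.
    have -> : dot w w + 2 * dot w d * e + dot d d * e ^+ 2 <= 1.
      by have := H e te; lra.
    by rewrite pmulr_lge0 ?exprn_gt0// => ->.
  by rewrite raddf0 addr0 defG.
have {wB}w1 : dot w w = 1 by apply/le_anti; rewrite wB.
(* On the sphere, small steps in a strictly inward direction stay in the ball. *)
have Gd d : dot w d < 0 -> 0 <= dot G d.
  move=> wd; have c0 : 0 < - (2 * dot w d) by lra.
  have [e e0 H] := small_quad_gt0 (- dot d d) 0 c0.
  apply: (feas d e e0) => t te; have /andP[t0 _] := te.
  by have := mulr_gt0 t0 (H t te); rewrite normE w1; lra.
(* [r] is the component of [G] orthogonal to [w]. It vanishes because the inward directions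
   [- r - t w] tend to [- r]. *)
pose k := - dot G w; pose r := G + k *: w.
have rw : dot r w = 0 by rewrite /r !dotDZ w1 /k; lra.
have GE : G = r - k *: w by rewrite /r addrK.
have defr : G + k *: w = r by [].
clearbody r.
have r0 : r = 0.
  apply/eqP; rewrite -dot_eq0; apply/eqP/le_anti; rewrite dot_ge0 andbT.
  rewrite -oppr_ge0; apply: (@small_quad_ge0 _ 1 _ k 0) => // t /andP[t0 _].
  have Gr : dot G r = dot r r by rewrite GE !dotDZ (dotC w) rw; ring.
  have := Gd (- r - t *: w); rewrite !dotDZ (dotC w r) rw w1 Gr.
  by rewrite -[dot G w]opprK -/k => H; have := H ltac:(lra); lra.
have k0 : 0 <= k.
  by have := Gd (- w); rewrite !dotNr w1 => H; apply: H; lra.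
pose mu := k / 2; have mu0 : 0 <= mu by rewrite divr_ge0.
pose N := M + mu%:M.
have Nd d : N *m d = M *m d + mu *: d by rewrite mulmxDl mul_scalar_mx.
have Ns : N^T = N by rewrite raddfD/= Ms tr_scalar_mx.
have Nsec d : dot w d != 0 -> 0 <= dot d (N *m d).
  move=> wd.
  have d0 : 0 < dot d d.
    by apply: dot_gt0; apply: contra_neq wd => ->; rewrite dot0r.
  pose s := - (2 * dot w d) / dot d d.
  have sd : dot d d * s = - (2 * dot w d) by rewrite /s mulrC divfK ?gt_eqF.
  have s2 : 0 < s ^+ 2.
    rewrite exprn_even_gt0//=; apply: contra_neq wd => s0.
    by move: sd; rewrite s0 mulr0; lra.
  have nE : dot (w + s *: d) (w + s *: d) = 1.
    by rewrite normE w1 expr2 mulrA sd; ring.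
  rewrite -(pmulr_rge0 _ s2) Nd !dotDZ.
  have := inc d s; rewrite nE lexx => /(_ isT).
  rewrite GE r0 sub0r !dotDZ.
  have -> : s ^+ 2 * (dot d (M *m d) + mu * dot d d) =
     s ^+ 2 * dot d (M *m d) + mu * s * (dot d d * s) by ring.
  by rewrite sd /mu; congr (0 <= _); field.
exists mu; split => //; last by rewrite w1; ring.
  (* A [d] orthogonal to [w] is the limit of [d + t w], which is not orthogonal to [w]. *)
  move=> d; have [wd|] := eqVneq (dot w d) 0; last exact: Nsec.
  apply: (@small_quad_ge0 _ 1 _ (2 * dot w (N *m d)) (dot w (N *m w))) => //.
  move=> t /andP[t0 _]; have := Nsec (d + t *: w).
  rewrite !dotDZ wd w1 (dot_sym d w Ns) => H.
  have := H ltac:(by rewrite add0r mulr1 gt_eqF).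
  by congr (0 <= _); ring.
rewrite Nd scalerDr scalerA /mu -addrA [_ *: w + b]addrC addrA defG.
by rewrite (mulrC 2) divfK ?pnatr_eq0// defr.
Qed.

(** Expanding around [w], the excess of the value at [y] is [(y - w)^T N (y - w) + mu (1 - |y|^2)].
    Both terms are nonnegative on the ball, so [y] is a minimizer exactly when both vanish. *)
Lemma argmin_ballE M b c w mu x : M^T = M -> unit_ball w -> 0 <= mu ->
  psd (M + mu%:M) -> 2 *: ((M + mu%:M) *m w) + b = 0 ->
  mu * (1 - dot w w) = 0 ->
  argmin (quad M b c) unit_ball x <->
  [/\ unit_ball x, (M + mu%:M) *m (x - w) = 0 & mu * (1 - dot x x) = 0].
Proof.
move=> Ms wB mu0; set N := M + mu%:M => Np Nw cs.
have Nd d : N *m d = M *m d + mu *: d by rewrite mulmxDl mul_scalar_mx.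
have Ns : N^T = N by rewrite raddfD/= Ms tr_scalar_mx.
have quadE y : quad M b c y = quad N b c y - mu * dot y y.
  by rewrite /quad Nd !dotDZ; ring.
have gap y : quad M b c y = quad M b c w +
    (dot (y - w) (N *m (y - w)) + mu * (1 - dot y y)).
  have := quadDZ b c w (y - w) 1 Ns.
  rewrite scale1r subrKC Nw [dot 0 _]dotC dot0r (quadE y) (quadE w) => ->.
  by move: cs; lra.
have gap0 y : unit_ball y -> 0 <= mu * (1 - dot y y).
  by rewrite unit_ballE => yB; rewrite mulr_ge0// subr_ge0.
split=> [[xB minx]|[xB Nx mx]].
  have := minx w wB; rewrite gap => H.
  have := Np (x - w); have := gap0 x xB => H1 H2.
  have dN0 : dot (x - w) (N *m (x - w)) = 0 by lra.
  by split=> //; [exact: psd_ker|lra].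
split=> // y yB; rewrite (gap x) (gap y) Nx mx dot0r.
by have := Np (y - w); have := gap0 y yB; lra.
Qed.

End TrustRegion.

(** * Geometry of the set of minimizers *)

Section TrustRegionSolutions.
Context {R : realType} {n : nat}.
Implicit Types (x y z u v w d e b : 'cV[R]_n) (M N : 'M[R]_n) (c k mu t : R).

Lemma segment_sqnorm x d t : dot (x + t *: d) (x + t *: d) =
  (1 - t) * dot x x + t * dot (x + d) (x + d) - t * (1 - t) * dot d d.
Proof. by rewrite !dotDZ (dotC d x); ring. Qed.

(** For nonzero [u], [x + k *: u] is the reflection of [x] in the hyperplane orthogonal to [u]. *)
Lemma reflect_sqnorm x u k : dot u u * k = - (2 * dot x u) ->
  dot (x + k *: u) (x + k *: u) = dot x x.
Proof.
move=> uk; rewrite !dotDZ (dotC u x) -[RHS]addr0 -(mulr0 k).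
by rewrite -(subrr (- (2 * dot x u))) -{1}uk; ring.
Qed.

Lemma chord_dot x d : dot (x + d) (x + d) = dot x x ->
  dot d d = - (2 * dot x d).
Proof. by rewrite !dotDZ (dotC d x); lra. Qed.

(* The points [x + k u(t)] obtained by reflecting [x] along
   [u(t) = t d + (1 - t) f], where [f] spans the orthogonal of [x] in the span
   of [d] and [e], join [x] (t = 0) to [x + d] (t = 1) on the sphere; clearing
   denominators makes [h] along this path a polynomial in [t]. *)
Lemma sphere_section_zero A a a0 x d e : A^T = A ->
  dot (x + d) (x + d) = dot x x -> dot (x + e) (x + e) = dot x x ->
  d != 0 -> e != 0 -> e != d ->
  quad A a a0 x < 0 -> 0 < quad A a a0 (x + d) ->
  exists i j, let v := x + (i *: d + j *: e) in
    dot v v = dot x x /\ quad A a a0 v = 0.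
Proof.
move=> As /chord_dot xd /chord_dot xe d0 e0 ed hx hd.
have dd0 := dot_gt0 d0; have ee0 := dot_gt0 e0.
pose f : 'cV[R]_n := dot d d *: e - dot e e *: d.
have fE : f = dot d d *: e - dot e e *: d by [].
clearbody f.
have xf : dot x f = 0.
  have xdE : dot x d = - (dot d d / 2) by rewrite xd; field.
  have xeE : dot x e = - (dot e e / 2) by rewrite xe; field.
  by rewrite fE !dotDZ xdE xeE; ring.
(* If [f = 0], comparing the norms of [|d|^2 e] and [|e|^2 d] gives [|d| = |e|], hence [e = d]. *)
have f0 : f != 0.
  apply: contraNneq ed => fz; have Ef := subr0_eq (etrans (esym fE) fz).
  have : dot (dot d d *: e) (dot d d *: e) = dot (dot e e *: d) (dot e e *: d).
    by rewrite Ef.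
  rewrite !dotDZ => H.
  have : (dot d d * dot e e) * (dot d d - dot e e) = 0 by lra.
  move=> /eqP; rewrite !mulf_eq0 (gt_eqF dd0) (gt_eqF ee0) subr_eq0 => /eqP de.
  by move: Ef; rewrite de => /(scalerI (lt0r_neq0 ee0)) ->.
have xd0 : dot x d != 0 by apply: contraTneq dd0 => xd0; rewrite xd xd0; lra.
pose u t : 'cV[R]_n := t *: d + (1 - t) *: f.
(* Pairing [u t = 0] with [x] forces [t = 0], but [u 0 = f] is nonzero. *)
have uu0 t : 0 < dot (u t) (u t).
  apply: dot_gt0; apply/eqP => ut.
  have : dot x (u t) = 0 by rewrite ut dot0r.
  rewrite /u !dotDZ xf mulr0 addr0 => /eqP.
  rewrite mulf_eq0 (negPf xd0) orbF => /eqP t0.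
  by move: ut; rewrite /u t0 subr0 scale0r add0r scale1r; exact/eqP.
pose G := 2 *: (A *m x) + a.
pose D : {poly R} := dot d d *: 'X^2 + (2 * dot d f) *: ('X * (1 - 'X)) +
  dot f f *: (1 - 'X) ^+ 2.
have DE t : D.[t] = dot (u t) (u t).
  by rewrite /u !hornerE /= !dotDZ (dotC f d); ring.
pose L : {poly R} := dot G d *: 'X + dot G f *: (1 - 'X).
have LE t : L.[t] = dot G (u t) by rewrite /u !hornerE /= !dotDZ; ring.
pose S : {poly R} := dot d (A *m d) *: 'X^2 +
  (2 * dot d (A *m f)) *: ('X * (1 - 'X)) + dot f (A *m f) *: (1 - 'X) ^+ 2.
have SE t : S.[t] = dot (u t) (A *m u t).
  by rewrite /u !hornerE /= !dotDZ (dot_sym f d As); ring.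
clearbody D L S.
pose H : {poly R} := quad A a a0 x *: D ^+ 2 + dot d d *: ('X * D * L) +
  (dot d d ^+ 2) *: ('X ^+ 2 * S).
(* The reflection coefficient [- 2 (x . u) / |u|^2], since [x . u = t (x . d)] and
   [|d|^2 = - 2 (x . d)]. *)
pose k t := t * dot d d / dot (u t) (u t).
have HE t : H.[t] = dot (u t) (u t) ^+ 2 * quad A a a0 (x + k t *: u t).
  rewrite quadDZ// -/G !hornerE /= DE LE SE /k.
  by field; exact: lt0r_neq0.
have k1 : k 1 *: u 1 = d.
  by rewrite /k /u subrr scale0r addr0 scale1r mul1r divff ?scale1r ?gt_eqF.
have k0 : k 0 *: u 0 = 0 by rewrite /k !mul0r scale0r.
have [||t _ /rootP] := @poly_ivt _ H 0 1; first exact: ler01.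
  rewrite !HE k0 k1 addr0 (pmulr_rle0 _ (exprn_gt0 2 (uu0 0))).
  by rewrite (pmulr_rge0 _ (exprn_gt0 2 (uu0 1))) !ltW.
rewrite HE => /eqP; rewrite mulf_eq0 (gt_eqF (exprn_gt0 2 (uu0 t))) => /eqP hv.
exists (k t * (t - (1 - t) * dot e e)), (k t * ((1 - t) * dot d d)).
have -> : (k t * (t - (1 - t) * dot e e)) *: d +
    (k t * ((1 - t) * dot d d)) *: e = k t *: u t.
  rewrite /u fE; apply/colP => i; rewrite !mxE; ring.
split => //; rewrite reflect_sqnorm// /k mulrC divfK ?gt_eqF//.
by rewrite /u !dotDZ xf xd; ring.
Qed.

Lemma argmin_ball_zero M b c A a a0 x y z : M^T = M -> A^T = A ->
  argmin (quad M b c) unit_ball x -> argmin (quad M b c) unit_ball y ->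
  argmin (quad M b c) unit_ball z -> z <> x -> z <> y ->
  quad A a a0 x < 0 -> 0 < quad A a a0 y ->
  exists2 v, argmin (quad M b c) unit_ball v & quad A a a0 v = 0.
Proof.
move=> Ms As Px Py Pz /eqP zx /eqP zy hx hy.
have xB : unit_ball x by case: Px.
have [mu [mu0 Np Nx cs]] := argmin_ball_kkt Ms Px.
have PE v := argmin_ballE c v Ms xB mu0 Np Nx cs.
have [yB Ny my] := (PE y).1 Py; have [zB Nz mz] := (PE z).1 Pz.
have xy : x != y by apply: contraTneq hx => ->; rewrite -leNgt ltW.
move: xB yB zB; rewrite !unit_ballE => xB yB zB.
set N := M + mu%:M in Np Nx PE Ny Nz; clearbody N.
set d := y - x in Ny; set e := z - x in Nz.
have yE : x + d = y by rewrite subrKC.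
have zE : x + e = z by rewrite subrKC.
(* For [mu = 0] the minimizers form a convex set, and the intermediate value theorem applies on the
   segment from [x] to [y]. *)
have [mu_0|mu_n0] := eqVneq mu 0.
  pose p : {poly R} := (quad A a a0 x)%:P +
    dot (2 *: (A *m x) + a) d *: 'X + dot d (A *m d) *: 'X^2.
  have pE t : p.[t] = quad A a a0 (x + t *: d) by rewrite quadDZ// !hornerE /=.
  have [||t /andP[t0 t1] pt] := @poly_ivt _ p 0 1; first exact: ler01.
    by rewrite !pE scale0r scale1r addr0 yE !ltW.
  exists (x + t *: d); last by rewrite -pE; exact/rootP.
  apply/PE; rewrite mu_0 mul0r; split => //.
    have t1' : 0 <= 1 - t by rewrite subr_ge0.
    have := mulr_ge0 (mulr_ge0 t0 t1') (dot_ge0 d).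
    have := ler_wpM2l t0 yB; have := ler_wpM2l t1' xB.
    by rewrite unit_ballE segment_sqnorm yE; lra.
  by rewrite addrAC subrr add0r -scalemxAr Ny scaler0.
have nrm v : mu * (1 - dot v v) = 0 -> dot v v = 1.
  by move=> /eqP; rewrite mulf_eq0 (negPf mu_n0) subr_eq0 => /eqP.
have x1 := nrm x cs; have y1 := nrm y my; have z1 := nrm z mz.
(* For [mu > 0] the third minimizer [z] supplies the second kernel direction [e], and the arc stays
   in [x + ker N]. *)
have [|||||||i [j [vv hv]]] := @sphere_section_zero A a a0 x d e As.
- by rewrite yE y1.
- by rewrite zE z1.
- by rewrite subr_eq0 eq_sym.
- by rewrite subr_eq0.
- by apply: contraNneq zy => ed; rewrite -zE ed yE.
- by [].
- by rewrite yE.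
exists (x + (i *: d + j *: e)) => //; apply/PE; split.
- by rewrite unit_ballE vv x1.
- by rewrite addrAC subrr add0r mulmxDr -!scalemxAr Ny Nz !scaler0 addr0.
- by rewrite vv x1 subrr mulr0.
Qed.

(* At a positive multiplier, the reflection of [x] along any [u] in the kernel
   of [M + mu I] is again a minimizer, hence [x] or [y]. *)
Lemma kernel_line M b c x y mu e : M^T = M -> x <> y ->
  argmin (quad M b c) unit_ball = [set x; y] ->
  0 < mu -> psd (M + mu%:M) -> 2 *: ((M + mu%:M) *m x) + b = 0 ->
  mu * (1 - dot x x) = 0 -> (M + mu%:M) *m e = 0 -> exists k, e = k *: (y - x).
Proof.
move=> Ms xy PE mu0 Np Nx cs Ne.
have Px : argmin (quad M b c) unit_ball x by rewrite PE; left.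
have Py : argmin (quad M b c) unit_ball y by rewrite PE; right.
have xB : unit_ball x by case: Px.
have PEv v := argmin_ballE c v Ms xB (ltW mu0) Np Nx cs.
have [_ Ny my] := (PEv y).1 Py.
set N := M + mu%:M in Np Nx PEv Ne Ny; clearbody N.
have d0 : y - x != 0 by rewrite subr_eq0 eq_sym; exact/eqP.
set d := y - x in Ny d0 *.
have yE : x + d = y by rewrite subrKC.
clearbody d.
have nrm v : mu * (1 - dot v v) = 0 -> dot v v = 1.
  by move=> /eqP; rewrite mulf_eq0 gt_eqF//= subr_eq0 => /eqP.
have x1 := nrm x cs; have y1 := nrm y my.
have dd : dot d d = - (2 * dot x d) by apply: chord_dot; rewrite yE y1.
have dd0 := dot_gt0 d0.
have xd0 : dot x d != 0 by apply: contraTneq dd0 => xd0; rewrite dd xd0; lra.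
pose k := dot x e / dot x d; exists k; apply/eqP; rewrite -subr_eq0.
(* [e - k d] is orthogonal to [x]; adding [d] makes [x . u = x . d] nonzero, so the reflection moves
   [x] and must reach [y]. *)
pose u : 'cV[R]_n := e - k *: d + d.
have xu : dot x u = dot x d by rewrite /u !dotDZ /k divfK// subrr add0r.
have u0 : u != 0 by apply: contra_neq xd0 => u0; rewrite -xu u0 dot0r.
pose s := dot d d / dot u u.
have us : dot u u * s = - (2 * dot x u).
  by rewrite /s mulrC divfK ?gt_eqF ?dot_gt0// xu.
have s0 : s != 0 by rewrite gt_eqF// divr_gt0// dot_gt0.
have : [set x; y] (x + s *: u).
  rewrite -PE; apply/PEv; rewrite unit_ballE reflect_sqnorm// x1.
  split; [by []| |by rewrite subrr mulr0].
  rewrite addrAC subrr add0r /u -scalemxAr !dotDZ.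
  by rewrite Ne Ny !scaler0 subrr addr0 scaler0.
case=> [|su].
  move=> /(congr1 (fun v => v - x)); rewrite addrAC subrr add0r => /eqP.
  by rewrite scaler_eq0 (negPf s0) (negPf u0).
rewrite /= -yE in su; move/addrI in su.
(* Pair [s u = d] with [x]; then [u = d], that is, [e = k d]. *)
have s1 : s = 1.
  apply: (mulIf xd0); rewrite mul1r -{1}xu -dotZr su //.
by rewrite -(addrK d (e - _)) -/u -[u]scale1r -s1 su subrr.
Qed.

End TrustRegionSolutions.

(** The vector [y - x] spans the kernel of the positive semidefinite matrix [M + mu I], so [- mu] is
    the smallest eigenvalue and its eigenspace is a line. *)
Lemma smallest_eigenvalue_mult1 (R : realType) (n : nat) (M : 'M[R]_n)
    (b : 'cV[R]_n) (c : R) : M^T = M ->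
  exactly_two_points (argmin (quad M b c) unit_ball) ->
  smallest_eigenvalue_mult M = 1%N.
Proof.
move=> Ms [x [y [xy PE]]].
have Px : argmin (quad M b c) unit_ball x by rewrite PE; left.
have Py : argmin (quad M b c) unit_ball y by rewrite PE; right.
have xB : unit_ball x by case: Px.
have [mu [mu0 Np Nx cs]] := argmin_ball_kkt Ms Px.
have PEv v := argmin_ballE c v Ms xB mu0 Np Nx cs.
have [yB Ny my] := (PEv y).1 Py.
have d0 : y - x != 0 by rewrite subr_eq0 eq_sym; exact/eqP.
(* If [mu = 0], the midpoint of [x] and [y] would be a third minimizer. *)
have {}mu0 : 0 < mu.
  rewrite lt_def mu0 andbT; apply/eqP => mu_0.
  have : [set x; y] (x + 2^-1 *: (y - x)).
    rewrite -PE; apply/PEv; split; last by rewrite mu_0 mul0r.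
      rewrite unit_ballE segment_sqnorm subrKC.
      have := dot_ge0 (y - x); move: xB yB; rewrite !unit_ballE; lra.
    by rewrite addrAC subrr add0r -scalemxAr Ny scaler0.
  have h0 : (2^-1 : R) != 0 by rewrite invr_neq0// pnatr_eq0.
  case=> /= [/(congr1 (fun v => v - x))|/(congr1 (fun v => v - y))].
    rewrite addrAC !subrr add0r => /eqP.
    by rewrite scaler_eq0 (negPf h0) (negPf d0).
  rewrite subrr => /eqP.
  have -> : x + 2^-1 *: (y - x) - y = (- 2^-1) *: (y - x).
    by apply/colP => i; rewrite !mxE; field.
  by rewrite scaler_eq0 oppr_eq0 (negPf h0) (negPf d0).
have NE v : (M + mu%:M) *m v = M *m v + mu *: v.
  by rewrite mulmxDl mul_scalar_mx.
(* Eigenvectors are rows here; symmetry of [M] turns them into kernel columns. *)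
have kerE (v : 'rV[R]_n) : v *m M = - mu *: v <-> (M + mu%:M) *m v^T = 0.
  rewrite NE -{1}Ms -[v in v *m _]trmxK -trmx_mul; split => [E|E].
    by rewrite -[M *m _]trmxK E linearZ/= scaleNr addNr.
  have /eqP := E; rewrite addr_eq0 => /eqP ->.
  by rewrite linearN linearZ/= trmxK scaleNr.
have eig : smallest_eigenvalue M = - mu.
  apply: (@minimumE _ _ id _ (- mu)); split.
    apply/eigenvalueP; exists (y - x)^T; first by apply/kerE; rewrite trmxK.
    by rewrite trmx_eq0.
  move=> k /eigenvalueP[v vM v0].
  have v0' : v^T != 0 by rewrite trmx_eq0.
  have := Np v^T; rewrite NE -{1}Ms -trmx_mul vM linearZ/= -scalerDl dotZr.
  by rewrite pmulr_lge0 ?dot_gt0// -lerBlDr sub0r.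
rewrite /smallest_eigenvalue_mult eig.
suff /eqmxP-> : (eigenspace M (- mu) == (y - x)^T)%MS.
  by rewrite rank_rV trmx_eq0 d0.
apply/andP; split; last by apply/eigenspaceP/kerE; rewrite trmxK.
apply/row_subP => i.
have /eigenspaceP/kerE := row_sub i (eigenspace M (- mu)).
move=> /(kernel_line Ms xy PE mu0 Np Nx cs)[k vk].
by rewrite -[row i _]trmxK vk linearZ/= scalemx_sub.
Qed.

(** * Lagrangian duality and the gap criterion *)

Section Duality.
Context {R : realType} {n : nat}.
Context (Q A : 'M[R]_n) (q a : 'cV[R]_n) (a0 : R).
Context (Qsym : Q^T = Q) (Asym : A^T = A).
Implicit Types (lam mu : R) (x y : 'cV[R]_n).

Let f := objf Q q.
Let h := conh A a a0.
Let L := lagrangian Q q A a a0.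
Let p := dualp Q q A a a0.
Let P := dualP Q q A a a0.

Lemma objf_quad : objf Q q = quad Q q 0.
Proof. by apply/funext => x; rewrite /objf /quad /dot mulmxA addr0. Qed.

Lemma conh_quad : conh A a a0 = quad A a (- a0).
Proof. by apply/funext => x; rewrite /conh /quad /dot mulmxA. Qed.

Lemma lagrangian_quad lam : lagrangian Q q A a a0 lam =
  quad (Q + lam *: A) (q + lam *: a) (- (lam * a0)).
Proof.
apply/funext => x; rewrite /lagrangian objf_quad conh_quad /quad.
by rewrite mulmxDl -scalemxAl !dotDZ; ring.
Qed.

Let symL lam : (Q + lam *: A)^T = Q + lam *: A.
Proof. by rewrite linearD linearZ/= Qsym Asym. Qed.

Let f_cont : continuous f.
Proof. by rewrite /f objf_quad; exact: quad_continuous. Qed.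

Let h_cont : continuous h.
Proof. by rewrite /h conh_quad; exact: quad_continuous. Qed.

Let L_cont lam : continuous (L lam).
Proof. by rewrite /L lagrangian_quad; exact: quad_continuous. Qed.

Let ball0 : (@unit_ball R n) !=set0.
Proof. by exists 0; rewrite unit_ballE dot0r ler01. Qed.

Let cball := @unit_ball_compact R n.

Let dualP_nonempty lam : P lam !=set0.
Proof. exact: argmin_nonempty. Qed.

Let dualpE lam x : P lam x -> p lam = L lam x.
Proof. exact: minimumE. Qed.

Let dualp_le lam x : unit_ball x -> p lam <= L lam x.
Proof.
have [y Py] := dualP_nonempty lam; rewrite (dualpE Py).
by case: Py => _; exact.
Qed.

Let LD lam e x : L (lam + e) x = L lam x + e * h x.
Proof. by rewrite /L /lagrangian -/h; ring. Qed.

Let dualP_of lam x : unit_ball x -> L lam x <= p lam -> P lam x.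
Proof.
by move=> xB Lx; split => // y yB; apply: le_trans Lx (dualp_le _ yB).
Qed.

(* Otherwise a slightly larger multiplier would have a larger dual value. *)
Let dualP_le0 lam : argmax p [set mu | 0 <= mu] lam ->
  exists2 x, P lam x & h x <= 0.
Proof.
move=> [lam0 maxl]; apply: contrapT => noP.
have hL x : unit_ball x -> h x <= 0 -> p lam < L lam x.
  move=> xB hx; rewrite ltNge; apply/negP => Lx.
  by apply: noP; exists x => //; exact: dualP_of.
have [e0 e00 He] :=
  perturbed_minimum_gt (@L_cont lam) h_cont cball (@dualp_le lam) hL.
have [x Px] := dualP_nonempty (lam + e0).
have /maxl : [set mu | 0 <= mu] (lam + e0) by rewrite /= addr_ge0// ltW.
rewrite leNgt (dualpE Px) LD He ?e00 ?lexx//; by case: Px.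
Qed.

(** Otherwise a slightly smaller multiplier, still nonnegative as [lam > 0], would have a larger
    dual value; the perturbation is by [- h]. *)
Let dualP_ge0 lam : 0 < lam -> argmax p [set mu | 0 <= mu] lam ->
  exists2 x, P lam x & 0 <= h x.
Proof.
move=> lam0 [_ maxl]; apply: contrapT => noP.
have hN_cont : continuous (fun x => -1 * h x).
  by apply: continuous_mul => //; exact: cst_continuous.
have hL x : unit_ball x -> -1 * h x <= 0 -> p lam < L lam x.
  move=> xB hx; rewrite ltNge; apply/negP => Lx.
  by apply: noP; exists x; [exact: dualP_of|lra].
have [e0 e00 He] :=
  perturbed_minimum_gt (@L_cont lam) hN_cont cball (@dualp_le lam) hL.
pose e := Num.min e0 lam.
have e_gt0 : 0 < e by rewrite lt_min e00.
have ee0 : e <= e0 by rewrite ge_min lexx.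
have [x Px] := dualP_nonempty (lam + - e).
have /maxl : [set mu | 0 <= mu] (lam + - e).
  by rewrite /= subr_ge0 ge_min lexx orbT.
rewrite leNgt (dualpE Px) LD; have -> : - e * h x = e * (-1 * h x) by ring.
by rewrite He ?e_gt0 ?ee0//; case: Px.
Qed.

Context (slater : minimum h unit_ball < 0).
Context (infeas : forall x, argmin f unit_ball x -> 0 < h x).

(** At [lam = 0] the Lagrangian is [f], whose minimizers all have [h > 0], against [dualP_le0]. *)
Let dual_lam_gt0 lam : argmax p [set mu | 0 <= mu] lam -> 0 < lam.
Proof.
move=> maxl; have [lam0 _] := maxl; rewrite lt_def lam0 andbT.
apply: contraPneq maxl => -> /dualP_le0[x P0x].
have L0 : L 0 = f by apply/funext => z; rewrite /L /lagrangian mul0r addr0.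
by move: P0x; rewrite /P /dualP -/L L0 => /infeas; rewrite leNgt => ->.
Qed.

(** For a primal solution [x], [p lam <= f x + lam h x <= f x]; equality puts [x] in [P lam] and
    forces [h x = 0]. Conversely, a zero of [h] in [P lam] is feasible with value [p lam]. *)
Let strong_dualityE lam : 0 < lam ->
  p lam = cdt_value Q q A a a0 <-> exists2 x, P lam x & h x = 0.
Proof.
move=> lam0.
have feasE : cdt_feasible A a a0 = unit_ball `&` [set x | h x <= 0].
  by apply/seteqP; split=> x [xB hx]; split => //; move: hx;
    rewrite /h /conh /= subr_le0.
(* [slater] provides a feasible point, so the primal value is attained and is not the default 0. *)
have [x [xB xmin]] : argmin f (cdt_feasible A a a0) !=set0.
  apply: argmin_nonempty => //; rewrite feasE; first exact: compact_sublevel.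
  have [x hx] := argmin_nonempty h_cont cball ball0.
  by exists x; split; [case: hx|rewrite /= -(minimumE hx) ltW].
have xfeas := xB; rewrite feasE in xB; case: xB => xB hx.
have -> : cdt_value Q q A a a0 = f x by exact: minimumE.
split=> [pf|[y Py hy]].
  have Lx : p lam <= L lam x by exact: dualp_le.
  have hx0 : lam * h x <= 0 by rewrite pmulr_rle0.
  have LE : L lam x = f x + lam * h x by [].
  exists x; first by apply: dualP_of => //; rewrite pf LE; lra.
  have /eqP : lam * h x = 0 by lra.
  by rewrite mulf_eq0 gt_eqF//= => /eqP.
have LE z : L lam z = f z + lam * h z by [].
have yB : unit_ball y by case: Py.
have fxy : f x <= f y by apply: xmin; rewrite feasE; split; rewrite //= hy.
have := dualp_le lam xB; rewrite (dualpE Py) !LE hy mulr0 addr0.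
have : lam * h x <= 0 by rewrite pmulr_rle0.
lra.
Qed.

Let hminmax lam x y : P lam = [set x; y] -> h x <= h y ->
  hmin Q q A a a0 lam = h x /\ hmax Q q A a a0 lam = h y.
Proof.
rewrite /hmin /hmax -/P -/h => -> hxy; split.
  by apply: minimumE; split; [left|move=> z [->|->]].
by apply: maximumE; split; [right|move=> z [->|->]].
Qed.

Lemma dual_gap_iff lam : argmax p [set mu | 0 <= mu] lam ->
  p lam <> cdt_value Q q A a a0 <-> exactly_two_points (P lam) /\
    0 \in `]hmin Q q A a a0 lam, hmax Q q A a a0 lam[%R.
Proof.
move=> maxl; have lam0 := dual_lam_gt0 maxl.
rewrite strong_dualityE//; split=> [noz|]; last first.
  move=> [[x [y [xy PE]]] h0 [z Pz hz]].
  wlog hxy : x y xy PE / h x <= h y.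
    move=> W; have [/W|/ltW/W] := leP (h x) (h y); first exact.
    by apply; [exact: nesym|rewrite PE setUC].
  have [hm hM] := hminmax PE hxy; move: h0 Pz; rewrite hm hM in_itv/= PE => h0.
  by case=> zE; move: h0; rewrite -zE hz ltxx ?andbF.
have [x Px hx] := dualP_le0 maxl; have [y Py hy] := dualP_ge0 lam0 maxl.
have {}hx : h x < 0.
  by rewrite lt_neqAle hx andbT; apply/eqP => hx0; apply: noz; exists x.
have {}hy : 0 < h y.
  by rewrite lt_neqAle hy andbT; apply/eqP => hy0; apply: noz; exists y.
have xy : x <> y by move=> E; move: hx; rewrite E ltNge ltW.
(* A third minimizer would yield a zero of [h] in [P lam], closing the gap. *)
have PE : P lam = [set x; y].
  apply/seteqP; split=> [z Pz|z [->|->]//].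
  apply: contrapT => /not_orP[zx zy]; apply: noz.
  move: Px Py Pz hx hy; rewrite /P /dualP lagrangian_quad /h conh_quad.
  move=> Px Py Pz hx hy.
  by have := argmin_ball_zero (symL lam) Asym Px Py Pz zx zy hx hy.
split; first by exists x, y.
have [-> ->] := hminmax PE (ltW (lt_trans hx hy)).
by rewrite in_itv/= hx hy.
Qed.

End Duality.

Theorem proposition3p2 (R : realType) (n : nat)
    (Q A : 'M[R]_n) (q a : 'cV[R]_n) (a0 : R)
    (Qsym : Q^T = Q) (Asym : A^T = A) (Apd : posdef A)
    (hslater : minimum (conh A a a0) unit_ball < 0)
    (hinfeas : forall x, argmin (objf Q q) unit_ball x -> 0 < conh A a a0 x)
    (lam : R)
    (lam_max : argmax (dualp Q q A a a0) [set mu | 0 <= mu] lam) :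
  (dualp Q q A a a0 lam <> cdt_value Q q A a a0 <->
     exactly_two_points (dualP Q q A a a0 lam) /\
     0 \in `]hmin Q q A a a0 lam, hmax Q q A a a0 lam[%R) /\
  (exactly_two_points (dualP Q q A a a0 lam) ->
     smallest_eigenvalue_mult (Q + lam *: A) = 1%N).
Proof.
split; first exact: dual_gap_iff.
rewrite /dualP lagrangian_quad; apply: smallest_eigenvalue_mult1.
by rewrite linearD linearZ/= Qsym Asym.
Qed.
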